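(* Let $I=(i_1,\dots,i_{d-1})$ and $J=(j_1,\dots,j_{d-1})$ be $(d-1)$-tuples of positive integers. Then the generalized pentagram maps on twisted $n$-gons in $\mathbb{RP}^d$ satisfy the duality $$T_{I,J}^{-1}=T_{J^*,I^*}\circ Sh,$$ where $Sh$ stands for some shift in the indices of vertices.
   Context: A twisted $n$-gon in $\mathbb{RP}^d$ with monodromy $M\in SL_{d+1}(\mathbb R)$ is a sequence $(v_k)_{k\in\mathbb Z}$ of points of $\mathbb{RP}^d$ with $v_{k+n}=Mv_k$ for all $k$. Polygons are generic and considered up to projective equivalence (the action of $SL_{d+1}(\mathbb R)$); it is assumed that the vertices are in general position and that every $d$ hyperplanes $P_i$ considered below intersect at one point. The maps are defined generically. For $I=(i_1,\dots,i_{d-1})$ the $I$-diagonal hyperplane is $P_k:=(v_k,v_{k+i_1},v_{k+i_1+i_2},\dots,v_{k+i_1+\dots+i_{d-1}})$, the hyperplane through these $d$ vertices. For $J=(j_1,\dots,j_{d-1})$ the generalized pentagram map is $$T_{I,J}v_k:=P_k\cap P_{k+j_1}\cap P_{k+j_1+j_2}\cap\dots\cap P_{k+j_1+\dots+j_{d-1}}.$$ $I^*=(i_{d-1},\dots,i_1)$ denotes the tuple $I$ taken in the opposite order, and similarly $J^*$. A shift in indices is a map $(v_k)_k\mapsto(v_{k+s})_k$ for a fixed $s\in\mathbb Z$. *)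

(* Defs.v *)
From HB Require Import structures.
From mathcomp Require Import all_boot all_order all_algebra.
From mathcomp Require Import reals.
From mathcomp Require Import mpoly.

Set Implicit Arguments.
Unset Strict Implicit.
Unset Printing Implicit Defensive.

Import Order.TTheory GRing.Theory Num.Theory.
Local Open Scope ring_scope.

(* Projective subspaces of RP^d are linear subspaces of the space of column
   vectors 'cV[R]_d.+1: points have dimension 1 and hyperplanes dimension d.
   A sequence is only known to consist of points once this is assumed, as in
   [twisted_ngon] and [pentagram_defined]. *)
Definition subspace_seq (R : realType) (d : nat) : Type :=
  int -> {vspace 'cV[R]_d.+1}.

Definition proj_act (R : realType) (d : nat) (M : 'M[R]_d.+1)
    (U : {vspace 'cV[R]_d.+1}) : {vspace 'cV[R]_d.+1} :=
  (linfun (mulmx M) @: U)%VS.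

Definition twisted_ngon (R : realType) (d n : nat) (M : 'M[R]_d.+1)
    (v : subspace_seq R d) : Prop :=
  [/\ \det M = 1,
      forall k, \dim (v k) = 1%N
    & forall k, v (k + n%:Z) = proj_act M (v k)].

Definition proj_equiv (R : realType) (d : nat) (v w : subspace_seq R d) : Prop :=
  exists2 g : 'M[R]_d.+1, \det g = 1 & forall k, w k = proj_act g (v k).

Definition shift (R : realType) (d : nat) (s : int) (v : subspace_seq R d) :
    subspace_seq R d :=
  fun k => v (k + s).

(* i_1 + ... + i_a *)
Definition partial_sum (I : seq nat) (a : nat) : int := (sumn (take a I))%:Z.

Definition diag_plane (R : realType) (d : nat) (I : seq nat)
    (v : subspace_seq R d) : subspace_seq R d :=
  fun k => (\sum_(a < d) v (k + partial_sum I a)%R)%VS.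

Definition pentagram (R : realType) (d : nat) (I J : seq nat)
    (v : subspace_seq R d) : subspace_seq R d :=
  fun k => (\bigcap_(a < d) diag_plane I v (k + partial_sum J a)%R)%VS.

Definition pentagram_defined (R : realType) (d : nat) (I J : seq nat)
    (v : subspace_seq R d) : Prop :=
  (forall k, \dim (diag_plane I v k) = d) /\
  (forall k, \dim (pentagram I J v k) = 1%N).

(* A twisted n-gon amounts to its monodromy M in SL_(d+1) and its vertices
   v_0, ..., v_(n-1), given by homogeneous coordinates (the columns of X).
   These data range over an irreducible variety, so Q is generic when it holds
   off the zero locus of a polynomial F in the entries of M and X that does not
   vanish identically on {det M = 1}. *)
Definition generically (R : realType) (d n : nat)
    (Q : subspace_seq R d -> Prop) : Prop :=
  exists F : {mpoly R[d.+1 * d.+1 + d.+1 * n]},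
    (exists (M : 'M[R]_d.+1) (X : 'M[R]_(d.+1, n)),
       \det M = 1 /\ F.@[row_mx (mxvec M) (mxvec X) 0] != 0) /\
    (forall (M : 'M[R]_d.+1) (X : 'M[R]_(d.+1, n)) (v : subspace_seq R d),
       twisted_ngon n M v ->
       (forall i : 'I_n, v (i%:Z) = <[col i X]>%VS) ->
       F.@[row_mx (mxvec M) (mxvec X) 0] != 0 -> Q v).

(* f and g, with domains of definition Df and Dg, are mutually inverse as
   generically defined maps on twisted n-gons: they send n-gons to n-gons, both
   composites are generically defined, and the graph of g is the transpose of
   the graph of f, both for polygons and for their projective classes. *)
Definition generically_inverse (R : realType) (d n : nat)
    (Df : subspace_seq R d -> Prop) (f : subspace_seq R d -> subspace_seq R d)
    (Dg : subspace_seq R d -> Prop) (g : subspace_seq R d -> subspace_seq R d) :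
    Prop :=
  [/\ forall M v, twisted_ngon n M v ->
        (Df v -> twisted_ngon n M (f v)) /\ (Dg v -> twisted_ngon n M (g v)),
      generically n (fun v => Df v /\ Dg (f v)),
      generically n (fun w => Dg w /\ Df (g w)),
      forall M N v w, twisted_ngon n M v -> twisted_ngon n N w ->
        Df v -> Dg w -> (f v =1 w <-> g w =1 v)
    & forall M N v w, twisted_ngon n M v -> twisted_ngon n N w ->
        Df v -> Dg w -> (proj_equiv (f v) w <-> proj_equiv (g w) v)].

(* Main.v *)
Require Import Defs.
From HB Require Import structures.
From mathcomp Require Import all_boot all_order all_algebra.
From mathcomp Require Import reals.
From mathcomp Require Import boolp mpoly zify.

Set Implicit Arguments.
Unset Strict Implicit.
Unset Printing Implicit Defensive.

Import Order.TTheory GRing.Theory Num.Theory.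
Local Open Scope ring_scope.

(** Write I' and J' for the tuples I and J in the opposite order, and |I|, |J|
    for their sums. Put w = T_{I,J} v, so that w_k is the intersection of the
    hyperplanes P_{k + j_1 + ... + j_a}. Read backwards, P_m contains all the
    points w_{m - (j_1 + ... + j_a)}, whose indices start at m - |J| and
    increase by the successive entries of J'; so P_m is the J'-diagonal
    hyperplane of w at m - |J|. In the same way v_m lies on all the
    P_{m - (i_1 + ... + i_a)}, and is their intersection. Both inclusions are
    equalities because the dimensions agree as soon as the two maps are defined.
    This gives
    [pentagram_revK]: T_{J',I'} o T_{I,J} is the shift by |I| + |J|. Applied
    also to (J', I') in place of (I, J), it shows that the two graphs are
    transposes of each other ([pentagram_inverse]). The passage to projective
    classes and the fact that the maps preserve twisted polygons are
    equivariance under projective maps and shifts.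

    It remains to see that the composites are generically defined. Spans of d
    points and intersections of d hyperplanes are both computed by the
    generalized cross product of d vectors in dimension d + 1
    ([span_cross], [bigcap_perp]), which is polynomial in the coordinates. Hence
    the coordinates of T v, and of a second map applied to T v, are polynomials
    in the monodromy and the vertices, and the maps are defined where their
    first coordinates do not vanish, for k in one period. These
    polynomials are not identically zero: take v_k with coordinates
    t^((2j - d) k), j = 0, ..., d, a twisted n-gon for every n. A nonzero
    linear form vanishing at d of these points amounts to a nonzero polynomial of
    degree at most d with d distinct positive roots; all coefficients of such a
    polynomial are nonzero, so all coordinates of the cross product are nonzero
    ([cross_geometric_neq0]). The cross products again have the form
    c_j t^(-(2j - d) k) with all c_j nonzero, so the argument can be iterated
    ([crossed_geometric]). *)

(** * Equivariance of the construction *)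

Definition act (R : realType) (d : nat) (M : 'M[R]_d.+1)
    (v : subspace_seq R d) : subspace_seq R d :=
  fun k => proj_act M (v k).

Lemma proj_act1 (R : realType) (d : nat) (U : {vspace 'cV[R]_d.+1}) :
  proj_act 1 U = U.
Proof.
rewrite /proj_act -[RHS]lim1g; apply: eq_in_limg => x _.
by rewrite lfunE /= mul1mx id_lfunE.
Qed.

Lemma proj_actM (R : realType) (d : nat) (A B : 'M[R]_d.+1)
    (U : {vspace 'cV[R]_d.+1}) :
  proj_act (A *m B) U = proj_act A (proj_act B U).
Proof.
rewrite /proj_act -limg_comp; apply: eq_in_limg => x _.
by rewrite comp_lfunE !lfunE /= mulmxA.
Qed.

Lemma proj_actK (R : realType) (d : nat) (M : 'M[R]_d.+1) :
  M \in unitmx -> cancel (@proj_act R d M) (proj_act (invmx M)).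
Proof. by move=> uM U; rewrite -proj_actM mulVmx ?proj_act1. Qed.

Lemma proj_actVK (R : realType) (d : nat) (M : 'M[R]_d.+1) :
  M \in unitmx -> cancel (proj_act (invmx M)) (@proj_act R d M).
Proof. by move=> uM U; rewrite -proj_actM mulmxV ?proj_act1. Qed.

Lemma proj_act_line (R : realType) (d : nat) (M : 'M[R]_d.+1) (x : 'cV_d.+1) :
  proj_act M <[x]> = <[M *m x]>%VS.
Proof. by rewrite /proj_act limg_line lfunE. Qed.

Lemma proj_act_sum (R : realType) (d : nat) (M : 'M[R]_d.+1) (I : finType)
    (U : I -> {vspace 'cV[R]_d.+1}) :
  proj_act M (\sum_i U i)%VS = (\sum_i proj_act M (U i))%VS.
Proof. exact: limg_sum. Qed.

(** Images only commute with intersections up to inclusion; invertibility of M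
    gives the reverse inclusion, by the same fact for the inverse of M. *)
Lemma proj_act_bigcap (R : realType) (d : nat) (M : 'M[R]_d.+1) (I : finType)
    (U : I -> {vspace 'cV[R]_d.+1}) :
  M \in unitmx ->
  proj_act M (\bigcap_i U i)%VS = (\bigcap_i proj_act M (U i))%VS.
Proof.
move=> uM; apply: subv_anti; rewrite {1}/proj_act limg_bigcap /=.
rewrite -{1}[(\bigcap_i _)%VS](proj_actVK uM); apply: limgS.
apply: subv_trans (limg_bigcap _ _ _ _) _.
apply/subv_bigcapP => i _; apply: (bigcapv_inf i) => //.
by rewrite -/(proj_act _ _) proj_actK.
Qed.

Lemma dim_proj_act (R : realType) (d : nat) (M : 'M[R]_d.+1)
    (U : {vspace 'cV[R]_d.+1}) :
  M \in unitmx -> \dim (proj_act M U) = \dim U.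
Proof.
have le_dim (A : 'M[R]_d.+1) V : (\dim (proj_act A V) <= \dim V)%N.
  by rewrite -(limg_ker_dim (linfun (mulmx A)) V) leq_addl.
move=> uM; apply: anti_leq; rewrite le_dim /=.
by rewrite -{1}(proj_actK uM U) le_dim.
Qed.

Lemma diag_plane_shift (R : realType) (d : nat) (I : seq nat) (s : int)
    (v : subspace_seq R d) :
  diag_plane I (shift s v) = shift s (diag_plane I v).
Proof. by apply: funext => k; apply: eq_bigr => a _; rewrite /shift addrAC. Qed.

(** Together with [pentagram_act], this yields that the image of a twisted
    polygon is twisted: being twisted says that a shift acts as a matrix. *)
Lemma pentagram_shift (R : realType) (d : nat) (I J : seq nat) (s : int)
    (v : subspace_seq R d) :
  pentagram I J (shift s v) = shift s (pentagram I J v).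
Proof.
apply: funext => k; rewrite /pentagram diag_plane_shift.
by apply: eq_bigr => a _; rewrite /shift addrAC.
Qed.

Lemma pentagram_defined_shift (R : realType) (d : nat) (I J : seq nat) (s : int)
    (v : subspace_seq R d) :
  pentagram_defined I J (shift s v) <-> pentagram_defined I J v.
Proof.
rewrite /pentagram_defined diag_plane_shift pentagram_shift.
split=> -[dimP dimT].
  by split=> k; move: (dimP (k - s)) (dimT (k - s)); rewrite /shift subrK.
by split=> k; [apply: (dimP (k + s)) | apply: (dimT (k + s))].
Qed.

Lemma diag_plane_act (R : realType) (d : nat) (I : seq nat) (M : 'M[R]_d.+1)
    (v : subspace_seq R d) :
  diag_plane I (act M v) = act M (diag_plane I v).
Proof. by apply: funext => k; rewrite /act /diag_plane proj_act_sum. Qed.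

Lemma pentagram_act (R : realType) (d : nat) (I J : seq nat) (M : 'M[R]_d.+1)
    (v : subspace_seq R d) :
  M \in unitmx -> pentagram I J (act M v) = act M (pentagram I J v).
Proof.
move=> uM; apply: funext => k.
by rewrite /pentagram diag_plane_act /act proj_act_bigcap.
Qed.

Lemma pentagram_defined_act (R : realType) (d : nat) (I J : seq nat)
    (M : 'M[R]_d.+1) (v : subspace_seq R d) :
  M \in unitmx ->
  pentagram_defined I J (act M v) <-> pentagram_defined I J v.
Proof.
move=> uM; rewrite /pentagram_defined diag_plane_act pentagram_act //.
by split=> -[dimP dimT]; split=> k;
  move: (dimP k) (dimT k); rewrite /act !dim_proj_act.
Qed.

Lemma det1_unitmx (R : realType) (d : nat) (M : 'M[R]_d.+1) :
  \det M = 1 -> M \in unitmx.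
Proof. by move=> detM; rewrite unitmxE detM unitr1. Qed.

Lemma twisted_ngon_shiftE (R : realType) (d n : nat) (M : 'M[R]_d.+1)
    (v : subspace_seq R d) :
  twisted_ngon n M v -> shift n%:Z v = act M v.
Proof. by case=> _ _ vM; apply: funext. Qed.

Lemma twisted_ngon_shift (R : realType) (d n : nat) (M : 'M[R]_d.+1) (s : int)
    (v : subspace_seq R d) :
  twisted_ngon n M v -> twisted_ngon n M (shift s v).
Proof.
case=> detM dimv vM; split; [exact: detM | by move=> k; apply: dimv | move=> k].
by rewrite /shift addrAC vM.
Qed.

Lemma twisted_ngon_pentagram (R : realType) (d n : nat) (I J : seq nat)
    (M : 'M[R]_d.+1) (v : subspace_seq R d) :
  twisted_ngon n M v -> pentagram_defined I J v ->
  twisted_ngon n M (pentagram I J v).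
Proof.
move=> vM [_ dimT]; have [detM _ _] := vM; split=> // k.
have := congr1 (pentagram I J) (twisted_ngon_shiftE vM).
rewrite pentagram_shift pentagram_act ?det1_unitmx //.
by move/(congr1 (fun w => w k)).
Qed.

(** * Duality *)

(** Partial sums of the opposite tuple are complementary partial sums, so
    that reversal of a tuple amounts to [rev_ord] on the index of summation. *)
Lemma partial_sum_rev (d : nat) (J : seq nat) (a : 'I_d) :
  size J = d.-1 ->
  partial_sum (rev J) a + partial_sum J (rev_ord a) = (sumn J)%:Z.
Proof.
move=> szJ; rewrite /partial_sum take_rev sumn_rev addrC -PoszD -sumn_cat.
have -> : (size J - a = rev_ord a)%N by rewrite szJ /=; lia.
by rewrite cat_take_drop.
Qed.

(** Each vertex on the left is by construction an intersection of hyperplanes,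
    one of which is the hyperplane on the right. *)
Lemma diag_plane_pentagram_rev (R : realType) (d : nat) (I J : seq nat)
    (v : subspace_seq R d) (k : int) :
  size J = d.-1 ->
  (diag_plane (rev J) (pentagram I J v) k
   <= diag_plane I v (k + (sumn J)%:Z)%R)%VS.
Proof.
move=> szJ; apply/subv_sumP => a _; apply: (bigcapv_inf (rev_ord a)) => //.
by rewrite -addrA partial_sum_rev.
Qed.

(** The duality itself: [diag_plane_pentagram_rev] is an inclusion of two
    hyperplanes, hence an equality, and after this substitution every hyperplane
    that is intersected passes through the same vertex of v. *)
Lemma pentagram_revK (R : realType) (d : nat) (I J : seq nat)
    (v : subspace_seq R d) :
  size I = d.-1 -> size J = d.-1 -> (forall k, \dim (v k) = 1%N) ->
  pentagram_defined I J v ->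
  pentagram_defined (rev J) (rev I) (pentagram I J v) ->
  pentagram (rev J) (rev I) (pentagram I J v)
  = shift ((sumn I)%:Z + (sumn J)%:Z) v.
Proof.
move=> szI szJ dimv [dimP _] [dimQ dimT]; apply: funext => k; apply/esym/eqP.
have eqPQ j : diag_plane (rev J) (pentagram I J v) j
              = diag_plane I v (j + (sumn J)%:Z).
  apply/eqP; rewrite eqEdim diag_plane_pentagram_rev //.
  by rewrite (dimP (j + _)) (dimQ j) leqnn.
rewrite eqEdim (dimT k) /shift dimv leqnn andbT.
apply/subv_bigcapP => a _; rewrite eqPQ.
apply: (sumv_sup (rev_ord a)) => //.
by rewrite -(partial_sum_rev a szI) -!addrA (addrC (sumn J)%:Z) ?addrA subvv.
Qed.

(** * Cross products *)

(** The block matrix (y | f), written entrywise so that no block decomposition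
    of the dimension intervenes. *)
Definition frame (A : comNzRingType) (d : nat) (y : 'cV[A]_d.+1)
    (f : 'I_d -> 'cV[A]_d.+1) : 'M[A]_d.+1 :=
  \matrix_(i, j) (if unlift ord0 j is Some a then f a i 0 else y i 0).

(** The vector representing the linear form y |-> det (frame y f). It is defined
    over any commutative ring because it is used both for real coordinates and
    for polynomials in indeterminate coordinates. *)
Definition cross (A : comNzRingType) (d : nat) (f : 'I_d -> 'cV[A]_d.+1) :
    'cV[A]_d.+1 :=
  \col_i \det (frame (delta_mx i 0) f).

(** Laplace expansion along the first column, whose cofactors do not depend on
    that column. *)
Lemma det_frame (A : comNzRingType) (d : nat) (y : 'cV[A]_d.+1)
    (f : 'I_d -> 'cV[A]_d.+1) :
  \det (frame y f) = \sum_i y i 0 * cross f i 0.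
Proof.
have cofactor_frame (z z' : 'cV[A]_d.+1) i :
    cofactor (frame z f) i ord0 = cofactor (frame z' f) i ord0.
  by congr (_ * \det _); apply/matrixP => j a; rewrite !mxE liftK.
have crossE i : cross f i 0 = cofactor (frame y f) i ord0.
  rewrite mxE (expand_det_col _ ord0) (bigD1 i) //= big1 => [|j ji].
    by rewrite addr0 !mxE unlift_none !eqxx mul1r (cofactor_frame _ y).
  by rewrite !mxE unlift_none (negPf ji) mul0r.
rewrite (expand_det_col _ ord0); apply: eq_bigr => i _.
by rewrite crossE mxE unlift_none.
Qed.

(** The determinant of a frame with a repeated column. *)
Lemma cross_orthogonal (A : comNzRingType) (d : nat)
    (f : 'I_d -> 'cV[A]_d.+1) (a : 'I_d) :
  \sum_i f a i 0 * cross f i 0 = 0.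
Proof.
rewrite -det_frame -det_tr; apply: (determinant_alternate (neq_lift ord0 a)).
by move=> i; rewrite !mxE unlift_none liftK.
Qed.

Lemma cross_neq0_arg (A : comNzRingType) (d : nat)
    (f : 'I_d -> 'cV[A]_d.+1) (a : 'I_d) :
  cross f != 0 -> f a != 0.
Proof.
apply: contraNneq => fa0; apply/eqP/colP => i.
rewrite [LHS]mxE [RHS]mxE (expand_det_col _ (lift ord0 a)) big1 // => j _.
by rewrite mxE liftK fa0 mxE mul0r.
Qed.

Lemma map_cross (A B : comNzRingType) (phi : {rmorphism A -> B}) (d : nat)
    (f : 'I_d -> 'cV[A]_d.+1) :
  cross (fun a => map_mx phi (f a)) = map_mx phi (cross f).
Proof.
apply/colP => i; rewrite !mxE -det_map_mx; congr (\det _).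
apply/matrixP => j l; rewrite !mxE.
case: unliftP => [a|] _; first by rewrite mxE.
by rewrite rmorph_nat.
Qed.

(** A nonzero coordinate of the cross product is the determinant of a frame
    completed by a vector of the standard basis; all rank computations below go
    through this invertible matrix. *)
Lemma frame_unit (K : fieldType) (d : nat) (f : 'I_d -> 'cV[K]_d.+1) :
  cross f != 0 ->
  exists2 i, cross f i 0 != 0 & frame (delta_mx i 0) f \in unitmx.
Proof.
case: (pickP (fun i => cross f i 0 != 0)) => [i ci _|c0 /eqP[]]; last first.
  by apply/colP => i; rewrite [RHS]mxE; apply/eqP/negbFE/c0.
by exists i => //; rewrite unitmxE unitfE; rewrite mxE in ci.
Qed.

Definition perp (K : fieldType) (d : nat) (p : 'cV[K]_d.+1) :
    {vspace 'cV[K]_d.+1} :=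
  lker (linfun (mulmx p^T) : 'Hom('cV[K]_d.+1, 'cV[K]_1)).

Lemma mem_perp (K : fieldType) (d : nat) (p x : 'cV[K]_d.+1) :
  (x \in perp p) = (\sum_i x i 0 * p i 0 == 0).
Proof.
have pxE : (p^T *m x) 0 0 = \sum_i x i 0 * p i 0.
  by rewrite mxE; apply: eq_bigr => i _; rewrite mxE mulrC.
rewrite memv_ker lfunE /= -pxE; apply/eqP/eqP => [-> | px0].
  by rewrite mxE.
by apply/matrixP => i j; rewrite !ord1 px0 mxE.
Qed.

Lemma dim_perp (K : fieldType) (d : nat) (p : 'cV[K]_d.+1) :
  p != 0 -> \dim (perp p) = d.
Proof.
move=> p0; pose f := linfun (mulmx p^T) : 'Hom('cV[K]_d.+1, 'cV[K]_1).
have := limg_ker_dim f fullv.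
have -> : \dim (limg f) = 1%N.
  apply: anti_leq; apply/andP; split.
    by apply: leq_trans (dimvS (subvf _)) _; rewrite dimvf dim_matrix.
  rewrite lt0n dimv_eq0 -lkerE; apply: contraNN p0 => /subvP ker_f.
  apply/eqP/colP => i; have := ker_f (delta_mx i 0) (memvf _).
  rewrite memv_ker lfunE /= => /eqP/matrixP/(_ 0 0).
  rewrite !mxE (bigD1 i) //= big1 => [|j ji].
    by rewrite !mxE !eqxx mulr1 addr0.
  by rewrite !mxE (negPf ji) mulr0.
by rewrite capfv dimvf dim_matrix mulr1 addn1 => -[].
Qed.

(** The columns of an invertible matrix are free, so the span has
    dimension d, as does the hyperplane orthogonal to the cross product, which
    contains it. *)
Lemma span_cross (K : fieldType) (d : nat) (f : 'I_d -> 'cV[K]_d.+1) :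
  cross f != 0 -> (\sum_a <[f a]>)%VS = perp (cross f).
Proof.
move=> f0; have [i ci uF] := frame_unit f0.
pose X := [tuple f a | a < d].
have spanX : <<X>>%VS = (\sum_a <[f a]>)%VS.
  by rewrite span_def big_map big_enum.
have freeX : free X.
  apply/freeP => k kX a.
  pose y : 'cV[K]_d.+1 := \col_j (if unlift ord0 j is Some b then k b else 0).
  have Fy : frame (delta_mx i 0) f *m y = 0.
    apply/colP => j; rewrite mxE big_ord_recl !mxE unlift_none mulr0 add0r.
    transitivity ((\sum_b k b *: X`_b) j 0); last by rewrite kX mxE.
    rewrite summxE; apply: eq_bigr => b _.
    by rewrite !mxE liftK -tnth_nth tnth_mktuple mulrC.
  have y0 : y = 0 by rewrite -[y](mulKmx uF) Fy mulmx0.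
  by have := congr1 (fun z : 'cV[K]_d.+1 => z (lift ord0 a) 0) y0;
    rewrite !mxE liftK.
apply/eqP; rewrite eqEdim dim_perp // -spanX (eqP freeX) size_tuple leqnn andbT.
rewrite spanX; apply/subv_sumP => a _.
by rewrite -memvE mem_perp cross_orthogonal.
Qed.

(** Dual to [span_cross]. Subtracting from x the multiple of the cross product
    with the same i-th coordinate gives a vector orthogonal to all the columns of
    an invertible frame, hence zero. *)
Lemma bigcap_perp (K : fieldType) (d : nat) (p : 'I_d -> 'cV[K]_d.+1) :
  cross p != 0 -> (\bigcap_b perp (p b))%VS = <[cross p]>%VS.
Proof.
have cross_perp b : (<[cross p]> <= perp (p b))%VS.
  rewrite -memvE mem_perp -[X in _ == X](cross_orthogonal p b).
  by apply/eqP/eq_bigr => i _; rewrite mulrC.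
move=> p0; have [i ci uF] := frame_unit p0; apply: subv_anti; apply/andP; split.
  apply/subvP => x /[!memvE] /subv_bigcapP xp.
  pose y := x - (x i 0 / cross p i 0) *: cross p.
  suff : y = 0.
    by move/eqP; rewrite subr_eq0 => /eqP->; rewrite -memvE memvZ ?memv_line.
  suff yF : y^T *m frame (delta_mx i 0) p = 0.
    by apply: trmx_inj; rewrite -[y^T](mulmxK uF) yF mul0mx trmx0.
  apply/rowP => j; rewrite !mxE; case: (unliftP ord0 j) => [b|] ->.
    transitivity (\sum_l y l 0 * p b l 0).
      by apply: eq_bigr => l _; rewrite !mxE liftK.
    by apply/eqP; rewrite -mem_perp rpredB ?rpredZ // ?memvE ?xp //.
  rewrite (bigD1 i) //= big1 => [|l li].
    rewrite !mxE unlift_none !eqxx mulr1 addr0.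
    by move: ci; rewrite mxE => ci; rewrite divfK ?subrr.
  by rewrite !mxE unlift_none (negPf li) mulr0.
by apply/subv_bigcapP.
Qed.

(** Applied to coordinates of vertices it gives the linear forms defining the
    diagonal hyperplanes; applied to these linear forms, with J for I, it gives
    coordinates of the pentagram map. *)
Definition crossed (A : comNzRingType) (d : nat) (I : seq nat)
    (V : int -> 'cV[A]_d.+1) : int -> 'cV[A]_d.+1 :=
  fun k => cross (fun a : 'I_d => V (k + partial_sum I a)).

Definition lines (R : realType) (d : nat) (V : int -> 'cV[R]_d.+1) :
    subspace_seq R d :=
  fun k => <[V k]>%VS.

Lemma diag_plane_crossed (R : realType) (d : nat) (I : seq nat)
    (V : int -> 'cV[R]_d.+1) (v : subspace_seq R d) (k : int) :
  (forall a : 'I_d, v (k + partial_sum I a) = lines V (k + partial_sum I a)) ->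
  crossed I V k != 0 -> diag_plane I v k = perp (crossed I V k).
Proof.
by move=> vV c0; rewrite -span_cross //; apply: eq_bigr => a _; apply: vV.
Qed.

Lemma crossed_neq0_arg (A : comNzRingType) (d : nat) (I : seq nat)
    (V : int -> 'cV[A]_d.+1) (k : int) (a : 'I_d) :
  crossed I V k != 0 -> V (k + partial_sum I a) != 0.
Proof.
exact: (cross_neq0_arg (f := fun a : 'I_d => V (k + partial_sum I a))).
Qed.

(** The hypothesis is local: it concerns only the vertices that enter in the
    construction at k. Two steps can thus be chained when only finitely many
    nonvanishing conditions are known. *)
Lemma pentagram_crossed (R : realType) (d : nat) (I J : seq nat)
    (V : int -> 'cV[R]_d.+1) (v : subspace_seq R d) (k : int) :
  (forall b a : 'I_d, v (k + partial_sum J b + partial_sum I a)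
     = lines V (k + partial_sum J b + partial_sum I a)) ->
  crossed J (crossed I V) k != 0 ->
  pentagram I J v k = lines (crossed J (crossed I V)) k.
Proof.
move=> vV c0; rewrite /lines -bigcap_perp //; apply: eq_bigr => b _.
by rewrite (diag_plane_crossed (vV b)) // (crossed_neq0_arg b c0).
Qed.

(** * A polygon at which every construction is defined *)

(** The coefficients alternate in sign, as elementary symmetric functions of
    positive numbers up to signs. *)
Lemma coef_prod_XsubC_neq0 (R : realDomainType) (s : seq R) (i : nat) :
  {in s, forall x, 0 < x} -> (i <= size s)%N ->
  (\prod_(x <- s) ('X - x%:P))`_i != 0.
Proof.
move=> s_gt0 le_i.
suff : 0 < (-1) ^+ (size s + i) * (\prod_(x <- s) ('X - x%:P))`_i.
  by apply: contraTneq => ->; rewrite mulr0 ltxx.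
elim: s i s_gt0 le_i => [|x s IHs] i s_gt0 le_i.
  by move: le_i; rewrite leqn0 => /eqP->; rewrite big_nil coef1 mulr1.
have x_gt0 : 0 < x by apply: s_gt0; rewrite mem_head.
have {}IHs j := IHs j (sub_in1 (fun y ys => mem_behead (s := x :: s) ys) s_gt0).
rewrite big_cons mulrBl coefB coefXM coefCM addSn.
case: i le_i => [|i] le_i /=.
  by rewrite sub0r exprS mulN1r mulrNN mulrCA mulr_gt0 ?IHs.
have [si|] := ltnP i (size s).
  rewrite mulrBr ltr_wpDl //.
    by rewrite addnS !exprS !mulN1r opprK ltW // IHs // ltnW.
  by rewrite exprS mulN1r mulNr opprK mulrCA mulr_gt0 ?IHs.
move=> si; have -> : i = size s by apply: anti_leq; rewrite si andbT.
rewrite [X in _ - x * X]nth_default ?size_prod_XsubC // mulr0 subr0.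
by rewrite addnS !exprS !mulN1r opprK IHs.
Qed.

(** Up to a constant such a polynomial is the product of the X - x, which has no
    vanishing coefficient. *)
Lemma sparse_poly_eq0 (R : realFieldType) (s : seq R) (p : {poly R}) (i : nat) :
  uniq s -> {in s, forall x, 0 < x} -> (size p <= (size s).+1)%N ->
  all (root p) s -> (i <= size s)%N -> p`_i = 0 -> p = 0.
Proof.
move=> s_uniq s_gt0 szp ps le_i pi0.
have /dvdpP[q Dp] : \prod_(x <- s) ('X - x%:P) %| p.
  by apply: uniq_roots_dvdp; rewrite // uniq_rootsE.
have [q0|q0] := eqVneq q 0; first by rewrite Dp q0 mul0r.
have /size_poly1P[c c0 Dq] : size q == 1%N.
  move: szp; rewrite Dp size_Mmonic ?monic_prod_XsubC //.
  rewrite size_prod_XsubC addnS /= -[X in (_ <= X)%N]add1n leq_add2r.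
  by rewrite -size_poly_gt0 in q0; case: (size q) q0 => [|[]].
have := coef_prod_XsubC_neq0 s_gt0 le_i.
by move: pi0; rewrite Dp Dq coefCM => /eqP;
  rewrite mulf_eq0 (negPf c0) /= => ->.
Qed.

Lemma partial_sum_inj (d : nat) (I : seq nat) :
  size I = d.-1 -> {in I, forall i, (0 < i)%N} ->
  injective (fun a : 'I_d => partial_sum I a).
Proof.
move=> szI I_gt0.
have lt_sum (a b : 'I_d) : (a < b)%N -> (sumn (take a I) < sumn (take b I))%N.
  move=> lt_ab; rewrite -(subnKC (ltnW lt_ab)) takeD sumn_cat -addn1 leq_add2l.
  have lt_aI : (a < size I)%N by rewrite szI; have := ltn_ord b; lia.
  rewrite (drop_nth 0%N lt_aI).
  have -> : (b - a)%N = (b - a).-1.+1 by lia.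
  by rewrite /= addn_gt0 I_gt0 ?mem_nth.
move=> a b []; case: (ltngtP a b) => [/lt_sum|/lt_sum|/val_inj//] /[swap] ->;
  by rewrite ltnn.
Qed.

(** These exponents are distinct, in arithmetic progression and of sum zero; the
    last property makes the monodromy of the special polygon have
    determinant 1. *)
Definition weight (d : nat) (j : 'I_d.+1) : int := j%:Z *+ 2 - d%:Z.

Definition geometric (R : realType) (d : nat) (t : R)
    (V : int -> 'cV[R]_d.+1) : Prop :=
  exists2 c : 'I_d.+1 -> R, (forall j, c j != 0)
    & forall k j, V k j 0 = c j * t ^ (weight j * k).

(** The sum of the weights is opposite to itself under [rev_ord]. *)
Lemma prod_weight (R : realType) (d : nat) (t : R) (k : int) :
  t != 0 -> \prod_(j < d.+1) t ^ (weight j * k) = 1.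
Proof.
move=> t0; have -> : \prod_(j < d.+1) t ^ (weight j * k)
                     = t ^ ((\sum_(j < d.+1) weight j) * k).
  rewrite mulr_suml; elim/big_rec2: _ => [|j m x _ ->]; first by rewrite expr0z.
  by rewrite expfzDr.
suff -> : \sum_(j < d.+1) weight j = 0 by rewrite mul0r expr0z.
have : \sum_(j < d.+1) weight j = - \sum_(j < d.+1) weight j.
  rewrite {1}(reindex_inj rev_ord_inj) /= -sumrN; apply: eq_bigr => j _.
  by rewrite /weight /=; have := ltn_ord j; lia.
lia.
Qed.

(** If the determinant of the completed frame vanishes, there is a nontrivial
    relation u between its rows. As the weights are in arithmetic progression,
    the relation on the columns V (K a) says that the polynomial with
    coefficients u_j c_j vanishes at the d positive numbers t^(2 K a), and the
    relation on the first column says that its i-th coefficient vanishes: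
    this is excluded by [sparse_poly_eq0]. *)
Lemma cross_geometric_neq0 (R : realType) (d : nat) (t : R)
    (V : int -> 'cV[R]_d.+1) (K : 'I_d -> int) (i : 'I_d.+1) :
  0 < t -> t != 1 -> geometric t V -> injective K ->
  cross (fun a => V (K a)) i 0 != 0.
Proof.
move=> t_gt0 t_neq1 [c c0 DV] injK; rewrite mxE; apply/det0P => -[u u0 uF].
have uF_col l : \sum_j u 0 j * frame (delta_mx i 0) (fun a => V (K a)) j l = 0.
  by have := congr1 (fun z : 'rV[R]_d.+1 => z 0 l) uF; rewrite !mxE.
have ui0 : u 0 i = 0.
  have := uF_col ord0; rewrite (bigD1 i) //= big1 => [|j ji].
    by rewrite addr0 !mxE unlift_none !eqxx mulr1.
  by rewrite !mxE unlift_none (negPf ji) mulr0.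
pose e j := u 0 (inord j) * c (inord j).
pose p := \poly_(j < d.+1) e j.
pose s := [seq t ^ (K a *+ 2) | a <- enum 'I_d].
have sz_s : size s = d by rewrite size_map size_enum_ord.
suff p0 : p = 0.
  case/eqP: u0; apply/rowP => j; rewrite mxE.
  have := congr1 (fun q : {poly R} => q`_j) p0.
  rewrite coef_poly ltn_ord coef0 /e inord_val => /eqP.
  by rewrite mulf_eq0 (negPf (c0 _)) orbF => /eqP.
apply: (@sparse_poly_eq0 _ s _ i).
- rewrite map_inj_uniq ?enum_uniq // => a b /(ieexprIz t_gt0 t_neq1).
  by move=> eqK; apply: injK; lia.
- by move=> _ /mapP[a _ ->]; rewrite exprz_gt0.
- by rewrite sz_s size_poly.
- apply/allP => _ /mapP[a _ ->]; rewrite /root horner_poly.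
  (* The factor t^(- d K a) turns powers of the root into the entries of V. *)
  have t0 : t ^ (- d%:Z * K a) != 0 by rewrite expfz_neq0 ?gt_eqF.
  rewrite -(mulIr_eq0 _ (mulIf t0)) mulr_suml.
  rewrite -[X in _ == X](uF_col (lift ord0 a)).
  apply/eqP/eq_bigr => j _; rewrite /e inord_val !mxE liftK DV.
  rewrite exprnP exprz_exp -!mulrA -expfzDr ?gt_eqF //.
  by congr (_ * (_ * t ^ _)); rewrite /weight; lia.
- by rewrite sz_s -ltnS.
- by rewrite coef_poly ltn_ord /e inord_val ui0 mul0r.
Qed.

(** Passing from 0 to k multiplies every vector by a diagonal matrix of
    determinant 1; linear forms are then multiplied by its inverse, whence the
    parameter t^-1. *)
Lemma crossed_geometric (R : realType) (d : nat) (t : R) (I : seq nat)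
    (V : int -> 'cV[R]_d.+1) :
  size I = d.-1 -> {in I, forall i, (0 < i)%N} -> 0 < t -> t != 1 ->
  geometric t V -> geometric t^-1 (crossed I V).
Proof.
move=> szI I_gt0 t_gt0 t_neq1 gV.
have t0 : t != 0 by rewrite gt_eqF.
exists (fun i => cross (fun a : 'I_d => V (partial_sum I a)) i 0).
  move=> i; apply: (@cross_geometric_neq0 _ _ t) => //.
  exact: partial_sum_inj.
have [c _ DV] := gV; move=> k i.
pose D := diag_mx (\row_(j < d.+1) t ^ (weight j * k)).
pose f (a : 'I_d) := V (k + partial_sum I a).
pose f0 (a : 'I_d) := V (partial_sum I a).
have DF : D *m frame (delta_mx i 0) f0
          = frame (t ^ (weight i * k) *: delta_mx i 0) f.
  apply/matrixP => j l; rewrite mul_diag_mx !mxE.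
  case: (unliftP ord0 l) => [a|] _.
    by rewrite /f /f0 !DV mulrDr expfzDr // mulrCA.
  by have [->//|_] := eqVneq j i; rewrite !mulr0.
have := congr1 determinant DF.
rewrite det_mulmx det_diag.
under eq_bigr do rewrite mxE.
rewrite prod_weight // mul1r => detF.
have -> : cross (fun a : 'I_d => f0 a) i 0
          = t ^ (weight i * k) * crossed I V k i 0.
  rewrite mxE detF det_frame (bigD1 i) //= big1 => [|j ji].
    by rewrite !mxE !eqxx mulr1 addr0.
  by rewrite !mxE (negPf ji) mulr0 mul0r.
by rewrite exprz_inv mulrAC -expfzDr // addrN expr0z mul1r.
Qed.

(** * Genericity *)

(** The vertices of a twisted polygon are prescribed on one period only; the
    other indices are reached by steps of a period in both directions. *)
Lemma int_periodic (n : nat) (P : int -> Prop) :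
  (forall i : 'I_n.+1, P i%:Z) -> (forall k, P k <-> P (k + n.+1%:Z)) ->
  forall k, P k.
Proof.
move=> P0 PS.
have Pmul m : forall k, P k <-> P (k + m%:Z * n.+1%:Z).
  elim: m => [|m IHm] k; first by rewrite mul0r addr0.
  apply: (iff_trans (IHm k)).
  by have -> : k + m.+1%:Z * n.+1%:Z = k + m%:Z * n.+1%:Z + n.+1%:Z by lia.
move=> k; rewrite (divz_eq k n.+1%:Z).
have : P (k %% n.+1%:Z)%Z.
  have r_lt : (`|(k %% n.+1%:Z)%Z| < n.+1)%N by lia.
  by have := P0 (Ordinal r_lt); congr P; rewrite /=; lia.
case: (k %/ n.+1%:Z)%Z => m; first by rewrite addrC -Pmul.
move: (k %% n.+1%:Z)%Z => r Pr; apply/(Pmul m.+1).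
by rewrite NegzE addrAC -mulrDl addNr mul0r add0r.
Qed.

(** The adjugate agrees with the inverse when the determinant is 1, and unlike
    the inverse it is polynomial in the entries. *)
Definition mxpowz (A : comNzRingType) (d : nat) (M : 'M[A]_d.+1) (q : int) :
    'M[A]_d.+1 :=
  match q with Posz m => M ^+ m | Negz m => (\adj M) ^+ m.+1 end.

Definition vertex_coord (A : comNzRingType) (d n : nat) (M : 'M[A]_d.+1)
    (X : 'M[A]_(d.+1, n.+1)) (k : int) : 'cV[A]_d.+1 :=
  mxpowz M (k %/ n.+1%:Z)%Z *m col (inord `|(k %% n.+1%:Z)%Z|) X.

Lemma mxpowzS (A : comNzRingType) (d : nat) (M : 'M[A]_d.+1) (q : int) :
  \det M = 1 -> mxpowz M (q + 1) = M *m mxpowz M q.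
Proof.
move=> detM; case: q => m; first by rewrite -PoszD addn1 /= exprS.
rewrite [RHS]/= exprS mulmxA mul_mx_adj detM mul1mx.
by case: m => [|m]; [|have -> : Negz m.+1 + 1 = Negz m by lia].
Qed.

Lemma vertex_coordD (A : comNzRingType) (d n : nat) (M : 'M[A]_d.+1)
    (X : 'M[A]_(d.+1, n.+1)) (k : int) :
  \det M = 1 -> vertex_coord M X (k + n.+1%:Z) = M *m vertex_coord M X k.
Proof.
move=> detM; rewrite /vertex_coord modzDr divzDr ?dvdzz // divzz /=.
by rewrite mxpowzS // mulmxA.
Qed.

Lemma vertex_coord_ord (A : comNzRingType) (d n : nat) (M : 'M[A]_d.+1)
    (X : 'M[A]_(d.+1, n.+1)) (i : 'I_n.+1) :
  vertex_coord M X i%:Z = col i X.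
Proof.
rewrite /vertex_coord divz_nat modz_nat divn_small ?modn_small ?ltn_ord //=.
by rewrite inord_val mul1mx.
Qed.

Lemma map_vertex_coord (A B : comNzRingType) (phi : {rmorphism A -> B})
    (d n : nat) (M : 'M[A]_d.+1) (X : 'M[A]_(d.+1, n.+1)) :
  vertex_coord (map_mx phi M) (map_mx phi X)
  = (fun k => map_mx phi (vertex_coord M X k)).
Proof.
apply: funext => k; rewrite /vertex_coord map_mxM map_col; congr (_ *m _).
by case: (_ %/ _)%Z => m /=; rewrite rmorphXn /= ?map_mx_adj.
Qed.

Lemma map_crossed (A B : comNzRingType) (phi : {rmorphism A -> B}) (d : nat)
    (I : seq nat) (V : int -> 'cV[A]_d.+1) :
  crossed I (fun k => map_mx phi (V k)) = (fun k => map_mx phi (crossed I V k)).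
Proof. by apply: funext => k; rewrite /crossed map_cross. Qed.

Lemma twisted_ngon_lines (R : realType) (d n : nat) (M : 'M[R]_d.+1)
    (X : 'M[R]_(d.+1, n.+1)) (v : subspace_seq R d) :
  twisted_ngon n.+1 M v -> (forall i : 'I_n.+1, v i%:Z = <[col i X]>%VS) ->
  v = lines (vertex_coord M X).
Proof.
move=> vM vX; have [detM _ _] := vM; apply: funext.
apply: (@int_periodic n) => [i|k]; first by rewrite vX /lines vertex_coord_ord.
have -> : v (k + n.+1%:Z) = proj_act M (v k).
  by have := twisted_ngon_shiftE vM; move/(congr1 (fun w => w k)).
rewrite {2}/lines vertex_coordD // -proj_act_line -/(lines _ _).
split=> [->//|]; exact: (can_inj (proj_actK (det1_unitmx detM))).
Qed.

Lemma pentagram_defined_crossed (R : realType) (d n : nat) (I J : seq nat)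
    (M : 'M[R]_d.+1) (V : int -> 'cV[R]_d.+1) (v : subspace_seq R d) :
  (0 < d)%N -> M \in unitmx -> shift n.+1%:Z v = act M v ->
  (forall (i : 'I_n.+1) (b a : 'I_d),
     v (i%:Z + partial_sum J b + partial_sum I a)
     = lines V (i%:Z + partial_sum J b + partial_sum I a)) ->
  (forall i : 'I_n.+1, crossed J (crossed I V) i%:Z != 0) ->
  pentagram_defined I J v.
Proof.
move=> d_gt0 uM vM vV W0.
have dim_periodic (T : subspace_seq R d) m : shift n.+1%:Z T = act M T ->
    (forall i : 'I_n.+1, \dim (T i%:Z) = m) -> forall k, \dim (T k) = m.
  move=> TM T0; apply: (@int_periodic n) => // k.
  by rewrite -/(shift _ _ _) TM /act dim_proj_act.
split; apply: dim_periodic.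
- by rewrite -diag_plane_shift vM diag_plane_act.
- move=> i; have := crossed_neq0_arg (Ordinal d_gt0) (W0 i).
  have := vV i (Ordinal d_gt0).
  rewrite /partial_sum take0 addr0 -/(partial_sum _ _) => vVi c0.
  by rewrite (diag_plane_crossed vVi) ?dim_perp.
- by rewrite -pentagram_shift vM pentagram_act.
- by move=> i; rewrite (pentagram_crossed (vV i)) // /lines dim_vline W0.
Qed.

(** The first coordinates of both steps over one period. Choosing a single
    coordinate costs nothing, since at the special polygon no coordinate
    vanishes. *)
Definition pentagram_minors (A : comNzRingType) (d n : nat)
    (I J I' J' : seq nat) (M : 'M[A]_d.+1) (X : 'M[A]_(d.+1, n.+1)) : A :=
  let W := crossed J (crossed I (vertex_coord M X)) in
  let U := crossed J' (crossed I' W) in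
  \prod_(k < n.+1) (W k%:Z 0 0 * U k%:Z 0 0).

Lemma pentagram_minors_neq0 (R : realType) (d n : nat) (I J I' J' : seq nat) :
  size I = d.-1 -> size J = d.-1 -> size I' = d.-1 -> size J' = d.-1 ->
  {in I, forall i, (0 < i)%N} -> {in J, forall i, (0 < i)%N} ->
  {in I', forall i, (0 < i)%N} -> {in J', forall i, (0 < i)%N} ->
  exists (M : 'M[R]_d.+1) (X : 'M[R]_(d.+1, n.+1)),
    \det M = 1 /\ pentagram_minors I J I' J' M X != 0.
Proof.
move=> szI szJ szI' szJ' I_gt0 J_gt0 I'_gt0 J'_gt0; pose t : R := 2.
have t_gt0 : 0 < t by rewrite ltr0n.
have t0 : t != 0 by rewrite gt_eqF.
have t_neq1 : t != 1 by rewrite gt_eqF // ltr1n.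
have tV_gt0 : 0 < t^-1 by rewrite invr_gt0.
have tV_neq1 : t^-1 != 1 by rewrite invr_eq1.
pose M : 'M[R]_d.+1 := diag_mx (\row_j t ^ (weight j * n.+1%:Z)).
pose X : 'M[R]_(d.+1, n.+1) := \matrix_(j, i) t ^ (weight j * i%:Z).
have detM : \det M = 1.
  by rewrite det_diag; under eq_bigr do rewrite mxE; rewrite prod_weight.
exists M, X; split=> //.
have gV : geometric t (vertex_coord M X).
  exists (fun=> 1) => [j|]; first by rewrite oner_eq0.
  apply: (@int_periodic n) => [i j|k].
    by rewrite vertex_coord_ord !mxE mul1r.
  have tk_neq0 (j : 'I_d.+1) : t ^ (weight j * n.+1%:Z) != 0.
    by rewrite expfz_neq0.
  have E j : vertex_coord M X (k + n.+1%:Z) j 0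
             = t ^ (weight j * n.+1%:Z) * vertex_coord M X k j 0.
    by rewrite vertex_coordD // mul_diag_mx !mxE.
  split=> DV j; first by rewrite E DV !mul1r mulrDr expfzDr // mulrC.
  apply: (mulfI (tk_neq0 j)); rewrite -E DV !mul1r mulrDr expfzDr //.
  exact: mulrC.
have gP := crossed_geometric szI I_gt0 t_gt0 t_neq1 gV.
have := crossed_geometric szJ J_gt0 tV_gt0 tV_neq1 gP; rewrite invrK => gW.
have gQ := crossed_geometric szI' I'_gt0 t_gt0 t_neq1 gW.
have := crossed_geometric szJ' J'_gt0 tV_gt0 tV_neq1 gQ; rewrite invrK => gU.
have neq0 V k j : geometric t V -> V k j 0 != 0.
  by case=> c c0 ->; rewrite mulf_neq0 // expfz_neq0.
by apply/prodf_neq0 => k _; rewrite mulf_neq0 ?neq0.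
Qed.

(** The polynomial is [pentagram_minors] at matrices of indeterminates: all the
    constructions commute with ring morphisms, in particular with evaluation.
    One statement serves both composites in the theorem, with the roles of the
    two maps exchanged. *)
Lemma pentagram_comp_generic (R : realType) (d n : nat)
    (I J I' J' : seq nat) :
  (0 < d)%N ->
  size I = d.-1 -> size J = d.-1 -> size I' = d.-1 -> size J' = d.-1 ->
  {in I, forall i, (0 < i)%N} -> {in J, forall i, (0 < i)%N} ->
  {in I', forall i, (0 < i)%N} -> {in J', forall i, (0 < i)%N} ->
  generically n.+1 (fun v : subspace_seq R d =>
    pentagram_defined I J v /\ pentagram_defined I' J' (pentagram I J v)).
Proof.
move=> d_gt0 szI szJ szI' szJ' I_gt0 J_gt0 I'_gt0 J'_gt0.
pose G : 'rV[{mpoly R[d.+1 * d.+1 + d.+1 * n.+1]}]_(d.+1 * d.+1 + d.+1 * n.+1)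
  := \row_i 'X_i.
exists (pentagram_minors I J I' J' (vec_mx (lsubmx G)) (vec_mx (rsubmx G))).
have evalG (M : 'M[R]_d.+1) (X : 'M[R]_(d.+1, n.+1)) :
    (pentagram_minors I J I' J' (vec_mx (lsubmx G)) (vec_mx (rsubmx G)))
      .@[row_mx (mxvec M) (mxvec X) 0] = pentagram_minors I J I' J' M X.
  set x := row_mx _ _ 0.
  have GE : map_mx (meval x) G = row_mx (mxvec M) (mxvec X).
    by apply/rowP => i; rewrite [LHS]mxE [G _ _]mxE mevalXU.
  have -> : M = map_mx (meval x) (vec_mx (lsubmx G)).
    by rewrite map_vec_mx map_lsubmx GE row_mxKl mxvecK.
  have -> : X = map_mx (meval x) (vec_mx (rsubmx G)).
    by rewrite map_vec_mx map_rsubmx GE row_mxKr mxvecK.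
  rewrite /pentagram_minors map_vertex_coord !map_crossed rmorph_prod.
  apply: eq_bigr => k _; rewrite [LHS]rmorphM.
  by congr (_ * _); rewrite [RHS]mxE.
split.
  have [M [X [detM F0]]] := pentagram_minors_neq0 R n szI szJ szI' szJ'
    I_gt0 J_gt0 I'_gt0 J'_gt0.
  by exists M, X; rewrite evalG.
move=> M X v vM vX; rewrite evalG => /prodf_neq0 F0.
have [detM _ _] := vM; have uM := det1_unitmx detM.
have vMs := twisted_ngon_shiftE vM.
have Dv := twisted_ngon_lines vM vX.
pose W := crossed J (crossed I (vertex_coord M X)).
have coord_neq0 (x : 'cV[R]_d.+1) : x 0 0 != 0 -> x != 0.
  by apply: contraNneq => ->; rewrite mxE.
have W0 (i : 'I_n.+1) : W i%:Z != 0.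
  by have := F0 i isT; rewrite mulf_eq0 negb_or => /andP[/coord_neq0].
have U0 (i : 'I_n.+1) : crossed J' (crossed I' W) i%:Z != 0.
  by have := F0 i isT; rewrite mulf_eq0 negb_or => /andP[_ /coord_neq0].
split.
  by apply: (pentagram_defined_crossed d_gt0 uM vMs _ W0); rewrite -Dv.
apply: (pentagram_defined_crossed d_gt0 uM _ _ U0).
  by rewrite -pentagram_shift vMs pentagram_act.
move=> i b a; apply: pentagram_crossed => [b' a'|]; first by rewrite -Dv.
exact: crossed_neq0_arg (crossed_neq0_arg b (U0 i)).
Qed.

(** * Mutually inverse maps *)

(** Both directions are [pentagram_revK], for (I, J) and for
    (rev J, rev I). *)
Lemma pentagram_inverse (R : realType) (d n : nat) (I J : seq nat) (s : int)
    (M N : 'M[R]_d.+1) (v w : subspace_seq R d) :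
  size I = d.-1 -> size J = d.-1 -> s = - ((sumn I)%:Z + (sumn J)%:Z) ->
  twisted_ngon n M v -> twisted_ngon n N w ->
  pentagram_defined I J v -> pentagram_defined (rev J) (rev I) w ->
  pentagram I J v = w <-> pentagram (rev J) (rev I) (shift s w) = v.
Proof.
move=> szI szJ Ds [_ dimv _] [_ dimw _] defv defw.
have shiftK (u : subspace_seq R d) a b : a + b = 0 -> shift a (shift b u) = u.
  by move=> ab; apply: funext => k; rewrite /shift -addrA ab addr0.
split=> Dw.
  rewrite -Dw in defw *; rewrite pentagram_shift pentagram_revK //.
  by apply: shiftK; rewrite Ds addNr.
move: defv; rewrite -Dw -{1}(revK I) -{1}(revK J) => defv.
rewrite -{1}(revK I) -{1}(revK J) pentagram_revK ?size_rev //.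
- by apply: shiftK; rewrite !sumn_rev Ds; lia.
- by move=> k; apply: dimw.
- exact/pentagram_defined_shift.
Qed.

Lemma twisted_ngon_act (R : realType) (d n : nat) (M g : 'M[R]_d.+1)
    (v : subspace_seq R d) :
  \det g = 1 -> twisted_ngon n M v ->
  twisted_ngon n (g *m M *m invmx g) (act g v).
Proof.
move=> detg vM; have ug := det1_unitmx detg; have [detM dimv vMk] := vM.
split=> [|k|k].
- by rewrite !det_mulmx det_inv detg detM invr1 !mulr1.
- by rewrite /act dim_proj_act.
- by rewrite /act vMk !proj_actM proj_actK.
Qed.

Theorem theorem1p4 (R : realType) (d n : nat) (I J : (d.-1).-tuple nat)
    (d_gt0 : (0 < d)%N) (n_gt0 : (0 < n)%N)
    (I_gt0 : forall i, i \in I -> (0 < i)%N)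
    (J_gt0 : forall j, j \in J -> (0 < j)%N) :
  exists s : int,
    @generically_inverse R d n
      (fun v => pentagram_defined I J v)
      (fun v => pentagram I J v)
      (fun w => pentagram_defined (rev J) (rev I) (shift s w))
      (fun w => pentagram (rev J) (rev I) (shift s w)).
Proof.
have szI := size_tuple I; have szJ := size_tuple J.
have szI' : size (rev I) = d.-1 by rewrite size_rev.
have szJ' : size (rev J) = d.-1 by rewrite size_rev.
have I'_gt0 i : i \in rev I -> (0 < i)%N by rewrite mem_rev; apply: I_gt0.
have J'_gt0 j : j \in rev J -> (0 < j)%N by rewrite mem_rev; apply: J_gt0.
have generic_sub (Q Q' : subspace_seq R d -> Prop) :
    (forall v, Q v -> Q' v) -> generically n Q -> generically n Q'.
  move=> QQ' [F [F0 FQ]]; exists F; split=> // M X v vM vX Fv.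
  exact: QQ' (FQ M X v vM vX Fv).
case: n n_gt0 => // n _ in generic_sub *.
pose s := - ((sumn I)%:Z + (sumn J)%:Z); exists s; split.
- move=> M v vM; split=> [|defv]; first exact: twisted_ngon_pentagram.
  by apply: twisted_ngon_pentagram defv; apply: twisted_ngon_shift.
- apply: generic_sub (pentagram_comp_generic R n d_gt0 szI szJ szJ' szI'
    I_gt0 J_gt0 J'_gt0 I'_gt0) => v [defv defw].
  by split=> //; apply/pentagram_defined_shift.
- apply: generic_sub (pentagram_comp_generic R n d_gt0 szJ' szI' szI szJ
    J'_gt0 I'_gt0 I_gt0 J_gt0) => w [defw defv].
  rewrite pentagram_shift.
  by split; apply/pentagram_defined_shift.
- move=> M N v w vM wN defv /pentagram_defined_shift defw.
  have inv := pentagram_inverse szI szJ (erefl s) vM wN defv defw.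
  by split=> /funext/inv->.
- move=> M N v w vM wN defv /pentagram_defined_shift defw.
  (* By equivariance, a projective map can be moved onto v or w, which reduces
     the claim to the duality of polygons. *)
  split=> -[g detg /funext]; rewrite -/(act _ _) => Dw;
    have ug := det1_unitmx detg;
    exists (invmx g); rewrite ?det_inv ?detg ?invr1 //.
  + have -> // : pentagram (rev J) (rev I) (shift s w) = act g v.
      apply/(pentagram_inverse szI szJ (erefl s) (twisted_ngon_act detg vM) wN).
      * exact/pentagram_defined_act.
      * exact: defw.
      * by rewrite pentagram_act.
    by move=> k; rewrite /act proj_actK.
  + have -> : pentagram I J v = act g w.
      apply/(pentagram_inverse szI szJ (erefl s) vM (twisted_ngon_act detg wN)).
      * exact: defv.
      * exact/pentagram_defined_act.
      * by rewrite Dw -pentagram_act.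
    by move=> k; rewrite /act proj_actK.
Qed.
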